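(* Let $\mathcal{L}(R_{k_1},\ldots,R_{k_p})$, $(k_1,\ldots,k_p)\in\mathbb{Z}^p$, be a family of oriented link diagrams which coincide outside $p$ disjoint discs and which in the $j$-th disc contain the 2-strand braid $x_1^{k_j}$ with both strands oriented in parallel (top to bottom). Let $D_{\mathcal{L}}(k_1,\ldots,k_p)(s)$ be the $D$ polynomial of $\mathcal{L}(R_{k_1},\ldots,R_{k_p})$, and for $a\in\mathbb{Z}$ put $R_0^{[a]}(s)=(1-a)s^{a}$ and $R_1^{[a]}(s)=a s^{a-1}$. Then for all $k_1,\ldots,k_p\in\mathbb{Z}$, $$D_{\mathcal{L}}(k_1,\ldots,k_p)(s)=\sum_{0\le j_1,\ldots,j_p\le 1}R_{j_1}^{[k_1]}(s)\cdots R_{j_p}^{[k_p]}(s)\,D_{\mathcal{L}}(j_1,\ldots,j_p)(s).$$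
   Context: The $D$ polynomial is the oriented link invariant with values in $\mathbb{C}[s,s^{-1}]$ obtained from the HOMFLY polynomial $P(l,m)$ (normalized by $P(\bigcirc)=1$, with skein relation $lP(L_+)+l^{-1}P(L_-)+mP(L_0)=0$) by the specialization $l=s$, $m=-2$; equivalently $D(\bigcirc)=1$ (unknot) and $sD(L_+)+s^{-1}D(L_-)-2D(L_0)=0$ whenever $L_+,L_-,L_0$ are oriented diagrams identical except near one crossing, where $L_+$ has a positive crossing (both strands pointing up, the over-strand goes from lower left to upper right), $L_-$ a negative crossing and $L_0$ the oriented smoothing. The 2-strand braid $x_1$ (generator of $\mathcal{B}_2$) is the crossing in which the strand going from top left to bottom right passes over the strand going from top right to bottom left; with both strands oriented from top to bottom it is a negative crossing (type $L_-$), and $x_1^{-1}$ is a positive crossing. *)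

(* Defs.v *)
(* MathComp, with the complex numbers R[i] over a realType R. *)
From HB Require Import structures.
From mathcomp Require Import all_boot all_order all_algebra.
From mathcomp Require Import reals complex.

Set Implicit Arguments.
Unset Strict Implicit.
Unset Printing Implicit Defensive.

Import Order.TTheory GRing.Theory Num.Theory.
Local Open Scope ring_scope.

(* Oriented link diagrams are put in general position with respect to the     *)
(* height function and read from top to bottom: a diagram is a word of        *)
(* slices, each containing one local maximum, one local minimum or one        *)
(* crossing.                                                                  *)

Inductive event :=
| Maxi of bool (* Maxi d creates two strands, oriented d and ~~ d *)
| Mini
| Cross of bool.
  (* Cross true: the strand going from top left to bottom right is over;
     Cross false: the strand going from top right to bottom left is over *)

(* Number of strands an event consumes and produces. *)
Definition nin (e : event) : nat := if e is Maxi _ then 0%N else 2%N.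
Definition nout (e : event) : nat := if e is Mini then 0%N else 2%N.

(* (i, e): the event e happens with exactly i strands on its left. *)
Definition slice : Type := nat * event.

(* A horizontal level of a diagram is the sequence, from left to right, of    *)
(* the orientations of the strands it meets (true: downwards).                *)
Definition level : Type := seq bool.

Definition act (e : event) (s : level) : option level :=
  match e, s with
  | Maxi d, _ => Some [:: d, ~~ d & s]
  | Mini, [:: a, b & s'] => if a != b then Some s' else None
  | Cross _, [:: a, b & s'] => Some [:: b, a & s']
  | _, _ => None
  end.

(* The level just below a slice; None if the slice does not fit. *)
Definition step (s : level) (x : slice) : option level :=
  if (x.1 <= size s)%N then omap (cat (take x.1 s)) (act x.2 (drop x.1 s))
  else None.

Definition run (s : level) (w : seq slice) : option level :=
  foldl (fun o x => obind (step^~ x) o) (Some s) w.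

Record link_diagram := LinkDiagram {
  word :> seq slice;
  _ : run [::] word == Some [::]
}.

HB.instance Definition _ := [isSub for word].

(* Planar isotopy (far, zigzag and slide moves) and Reidemeister moves for    *)
(* diagrams in this position; orientations are carried along.                 *)
(* The remaining versions of the first and third Reidemeister moves follow    *)
(* from these.                                                                *)
Inductive move : seq slice -> seq slice -> Prop :=
| move_far i k e f :
    move [:: (i, e); ((i + nout e + k)%N, f)]
         [:: ((i + nin e + k)%N, f); (i, e)]
| move_zigzag_l i d : move [:: (i, Maxi d); (i.+1, Mini)] [::]
| move_zigzag_r i d : move [:: (i.+1, Maxi d); (i, Mini)] [::]
| move_slide_maxi i d o :
    move [:: (i, Maxi d); (i.+1, Cross o)] [:: (i.+1, Maxi d); (i, Cross (~~ o))]
| move_slide_mini i o :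
    move [:: (i.+1, Cross o); (i, Mini)] [:: (i, Cross (~~ o)); (i.+1, Mini)]
| move_R1_maxi i d o :
    move [:: (i, Maxi d); (i, Cross o)] [:: (i, Maxi (~~ d))]
| move_R1_mini i o : move [:: (i, Cross o); (i, Mini)] [:: (i, Mini)]
| move_R2 i o : move [:: (i, Cross o); (i, Cross (~~ o))] [::]
| move_R3 i o :
    move [:: (i, Cross o); (i.+1, Cross o); (i, Cross o)]
         [:: (i.+1, Cross o); (i, Cross o); (i.+1, Cross o)].

Definition link_invariant (T : Type) (D : link_diagram -> T) : Prop :=
  forall (u v x y : seq slice) (L L' : link_diagram),
    move x y -> word L = u ++ x ++ v -> word L' = u ++ y ++ v -> D L = D L'.

(* The oriented smoothing of a crossing whose two upper ends are oriented a   *)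
(* and b. *)
Definition smoothing (i : nat) (a b : bool) : seq slice :=
  if a == b then [::] else [:: (i, Mini); (i, Maxi b)].

(* Lp, Ln, L0 coincide except near one crossing, which is positive, negative, *)
(* smoothed. For a = b the two strands are parallel, and the positive         *)
(* crossing is the one whose over-strand joins the lower left to the upper    *)
(* right, i.e. Cross false; a != b is the same local picture turned by a      *)
(* quarter of a turn, so the positive crossing is then Cross true.            *)
Definition skein_triple (Lp Ln L0 : link_diagram) : Prop :=
  exists (u v : seq slice) (i : nat) (s t : level) (a b : bool),
    [/\ run [::] u = Some s /\ drop i s = [:: a, b & t],
        word Lp = u ++ (i, Cross (a != b)) :: v,
        word Ln = u ++ (i, Cross (a == b)) :: v
      & word L0 = u ++ smoothing i a b ++ v].

(* The field C(s), which contains C[s, s^-1]. *)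
Notation ratfun R := {fraction {poly complex R}}.

Section Dpolynomial.
Variable R : realType.

Definition var_s : ratfun R := tofrac ('X : {poly R[i]}).

Definition laurent (f : ratfun R) : Prop :=
  exists (q : {poly R[i]}) (n : nat), f = tofrac q / var_s ^+ n.

(* D is the invariant obtained from the HOMFLY polynomial at l = s, m = -2. *)
Record is_D_polynomial (D : link_diagram -> ratfun R) : Prop := {
  D_laurent : forall L, laurent (D L);
  D_invariant : link_invariant D;
  D_unknot : forall (L : link_diagram) (d : bool),
    word L = [:: (0%N, Maxi d); (0%N, Mini)] -> D L = 1;
  D_skein : forall Lp Ln L0 : link_diagram, skein_triple Lp Ln L0 ->
    var_s * D Lp + var_s^-1 * D Ln - 2 * D L0 = 0
}.

Definition Rcoef (j : 'I_2) (a : int) : ratfun R :=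
  if j == 0 then (1 - a)%:~R * var_s ^ a else a%:~R * var_s ^ (a - 1).

End Dpolynomial.

(* The braid x_1^k on the strands i and i + 1. *)
Definition braid (i : nat) (k : int) : seq slice :=
  match k with
  | Posz n => nseq n (i, Cross true)
  | Negz n => nseq n.+1 (i, Cross false)
  end.

(* The common part of a family of diagrams, with p numbered discs. *)
Inductive item (p : nat) :=
| Fixed of slice
| Disc of 'I_p & nat. (* Disc j i: the j-th disc meets the strands i, i + 1 *)

Definition disc_label (p : nat) (x : item p) : option 'I_p :=
  if x is Disc j _ then Some j else None.

(* Both strands meeting a disc are oriented downwards, above and below it. *)
Definition item_step (p : nat) (s : level) (x : item p) : option level :=
  match x with
  | Fixed y => step s y
  | Disc _ i => if take 2 (drop i s) == [:: true; true] then Some s else None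
  end.

Definition item_run (p : nat) (s : level) (t : seq (item p)) : option level :=
  foldl (fun o x => obind (@item_step p ^~ x) o) (Some s) t.

Record disc_family (p : nat) := DiscFamily {
  template :> seq (item p);
  template_run : item_run [::] template = Some [::];
  template_discs : perm_eq (pmap (@disc_label p) template) (enum 'I_p)
}.

Definition fill_item (p : nat) (k : {ffun 'I_p -> int}) (x : item p) :
    seq slice :=
  match x with
  | Fixed y => [:: y]
  | Disc j i => braid i (k j)
  end.

Definition fill (p : nat) (k : {ffun 'I_p -> int}) (t : seq (item p)) :
    seq slice :=
  flatten [seq fill_item k x | x <- t].

Lemma run_cat (s : level) (u v : seq slice) :
  run s (u ++ v) = obind (run^~ v) (run s u).
Proof.
rewrite /run foldl_cat; case: (foldl _ _ u) => //=.
by elim: v.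
Qed.

Lemma run_braid (s : level) (i : nat) (k : int) :
  take 2 (drop i s) = [:: true; true] -> run s (braid i k) = Some s.
Proof.
move=> H.
have stepE o : step s (i, Cross o) = Some s.
  have lis : (i <= size s)%N.
    by rewrite leqNgt; apply/negP => /ltnW lsi; rewrite drop_oversize in H.
  rewrite /step /= lis -[in RHS](cat_take_drop i s).
  by case: (drop i s) H => [|a [|b t]] //= [-> ->].
have runE n o : run s (nseq n (i, Cross o)) = Some s.
  by rewrite /run; elim: n => //= n IHn; rewrite stepE.
by case: k => n; apply: runE.
Qed.

Lemma run_fill (p : nat) (k : {ffun 'I_p -> int}) (t : seq (item p))
    (s s' : level) :
  item_run s t = Some s' -> run s (fill k t) = Some s'.
Proof.
have NoneE (r : seq (item p)) :
    foldl (fun o x => obind (@item_step p ^~ x) o) None r = None by elim: r.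
elim: t s => [|x t IHt] s //=.
rewrite /item_run /= /fill /= run_cat.
case: x => [y|j i] /=.
  rewrite /run /=.
  by case: (step s y) => [s1|] /=; [apply: IHt | rewrite NoneE].
case: eqP => [/run_braid -> /= |_]; [exact: IHt | by rewrite NoneE].
Qed.

Lemma fill_subproof (p : nat) (F : disc_family p) (k : {ffun 'I_p -> int}) :
  run [::] (fill k F) == Some [::].
Proof. by rewrite (run_fill k (template_run F)). Qed.

(* The diagram with x_1^(k j) in the j-th disc. *)
Definition family_diagram (p : nat) (F : disc_family p)
    (k : {ffun 'I_p -> int}) : link_diagram :=
  LinkDiagram (fill_subproof F k).

(* Main.v *)
(* With parallel strands, the skein relation at a crossing added to x_1^a says
   that f(a) = D(.., x_1^a, ..) satisfies s f(a-1) + s^-1 f(a+1) = 2 f(a).  The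
   characteristic polynomial has the double root s, so f(a) = (A + B a) s^a,
   that is, f(a) = R_0^[a] f(0) + R_1^[a] f(1).  Both sides of the theorem obey
   this rule in each coordinate and they agree on {0,1}^p. *)
Require Import Defs.
From mathcomp Require Import all_boot all_order all_algebra.
From mathcomp Require Import reals complex.
From mathcomp Require Import ring zify.
Import GRing.Theory.
Local Open Scope ring_scope.

Lemma double_root_recurrence {K : fieldType} (s : K) (f : int -> K) :
    s != 0 ->
    (forall a, s * f (a - 1) + s^-1 * f (a + 1) - 2 * f a = 0) ->
  forall a, f a = (1 - a)%:~R * s ^ a * f 0 + a%:~R * s ^ (a - 1) * f 1.
Proof.
move=> s0 rec a.
pose g a := (1 - a)%:~R * s ^ a * f 0 + a%:~R * s ^ (a - 1) * f 1.
(* The recurrence has order two, so two consecutive values are carried together; the induction then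
   runs in both directions from 0. *)
suff [] : f a = g a /\ f (a + 1) = g (a + 1) by [].
(* With [s ^ b] factored out, [field] can treat it as an atom when the recurrence is checked for
   [g]. *)
have gE b : g b = s ^ b * ((1 - b%:~R) * f 0 + b%:~R * s^-1 * f 1).
  by rewrite /g intrB expfzDr // exprN1; ring.
have grec b : s * g (b - 1) + s^-1 * g (b + 1) - 2 * g b = 0.
  by rewrite !gE !expfzDr // exprN1 expr1z !intrD; field.
have up b : f (b - 1) = g (b - 1) -> f b = g b -> f (b + 1) = g (b + 1).
  move=> e1 e2; have := rec b; rewrite -(grec b) e1 e2.
  by move/addIr/addrI/mulfI; apply; rewrite invr_eq0.
have down b : f (b + 1) = g (b + 1) -> f b = g b -> f (b - 1) = g (b - 1).
  move=> e1 e2; have := rec b; rewrite -(grec b) e1 e2.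
  by move/addIr/addIr/mulfI; apply.
elim/int_rect: a => [|n [IH1 IH2]|n [IH1 IH2]].
- by split; rewrite gE ?expr0z ?expr1z ?add0r ?subr0; field.
- have -> : n.+1%:Z = n%:Z + 1 by lia.
  by split=> //; apply: up; rewrite ?addrK.
- have -> : - n.+1%:Z = - n%:Z - 1 by lia.
  by rewrite subrK; split=> //; apply: down.
Qed.

Definition setc {p : nat} (k : {ffun 'I_p -> int}) (r : 'I_p) (a : int) :
    {ffun 'I_p -> int} :=
  [ffun q => if q == r then a else k q].

Section Interpolation.
Context {R : realType} {p : nat}.
Implicit Types (f : {ffun 'I_p -> int} -> ratfun R) (k : {ffun 'I_p -> int}).

Definition coordinatewise f : Prop :=
  forall k r, f k = Rcoef R 0 (k r) * f (setc k r 0)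
                  + Rcoef R 1 (k r) * f (setc k r 1).

(** The right-hand side of the theorem, for an arbitrary [f] in place of the $D$ polynomial. *)
Definition interpolant f k : ratfun R :=
  \sum_(j : {ffun 'I_p -> 'I_2})
     (\prod_(r < p) Rcoef R (j r) (k r)) * f [ffun r => Posz (j r)].

(** Makes $R_0$, $R_1$ a Lagrange basis for the nodes 0 and 1. *)
Lemma Rcoef_delta (j i : 'I_2) : Rcoef R j (Posz i) = (j == i)%:R.
Proof.
rewrite /Rcoef; case: i => [[|[|//]] ?]; case: j => [[|[|//]] ?] //=.
- by rewrite expr0z mulr1.
- by rewrite mul0r.
- by rewrite subrr mul0r.
- by rewrite subrr expr0z mulr1.
Qed.

(** Holds term by term: a summand depends on [k r] through the single factor [Rcoef R (j r) (k r)],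
    and the Lagrange property settles that factor. *)
Lemma interpolant_coordinatewise f : coordinatewise (interpolant f).
Proof.
move=> k r; rewrite /interpolant !mulr_sumr -big_split /=.
apply: eq_bigr => j _; rewrite !mulrA -mulrDl; congr (_ * _).
have prodE a : \prod_(q < p) Rcoef R (j q) (setc k r a q)
    = Rcoef R (j r) a * \prod_(q < p | q != r) Rcoef R (j q) (k q).
  rewrite (bigD1 r) //= ffunE eqxx; congr (_ * _).
  by apply: eq_bigr => q /negbTE qr; rewrite ffunE qr.
rewrite !prodE (bigD1 r) //= !mulrA -mulrDl; congr (_ * _).
rewrite (Rcoef_delta _ 0) (Rcoef_delta _ 1).
case: (j r) => [[|[|//]] lt2].
- by rewrite (_ : Ordinal lt2 = 0) ?mulr1 ?mulr0 ?addr0 //; apply: val_inj.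
- by rewrite (_ : Ordinal lt2 = 1) ?mulr1 ?mulr0 ?add0r //; apply: val_inj.
Qed.

Lemma interpolant01 f (j : {ffun 'I_p -> 'I_2}) :
  interpolant f [ffun r => Posz (j r)] = f [ffun r => Posz (j r)].
Proof.
rewrite /interpolant (bigD1 j) //= big1 => [|r _]; last first.
  by rewrite ffunE Rcoef_delta eqxx.
rewrite mul1r big1 ?addr0 // => i ij.
have [r jr] : exists r, i r != j r.
  apply/existsP; rewrite -negb_forall; apply: contra ij => /forallP ij.
  by apply/eqP/ffunP => r; apply/eqP.
by rewrite (bigD1 r) //= ffunE Rcoef_delta (negbTE jr) !mul0r.
Qed.

(** Induction on the number of coordinates outside {0,1}: resetting one of them to 0 or 1 lowers
    this number, and at zero the point is a node. *)
Lemma coordinatewise_interpolant f : coordinatewise f -> f =1 interpolant f.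
Proof.
move=> cf k; pose A k := [set r | (k r != 0) && (k r != 1)].
have [n] := ubnP #|A k|; elim: n k => // n IHn k /ltnSE leAn.
have [A0|[r rA]] := set_0Vmem (A k).
  pose j : {ffun 'I_p -> 'I_2} := [ffun r => if k r == 0 then 0 else 1].
  suff -> : k = [ffun r => Posz (j r)] by rewrite interpolant01.
  apply/ffunP => r; rewrite !ffunE.
  by move/setP/(_ r): A0; rewrite !inE; case: eqP => //= _; case: eqP.
have IHr a : a \in [:: 0; 1] -> f (setc k r a) = interpolant f (setc k r a).
  move=> a01; apply: IHn; apply: leq_trans leAn; apply: proper_card.
  apply/properP; split; last first.
    by exists r => //; rewrite inE ffunE eqxx; move: a01; rewrite !inE; do 2!case: eqP.
  apply/subsetP => q; rewrite !inE ffunE; case: (q =P r) => // _.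
  by move: a01; rewrite !inE; do 2!case: eqP.
by rewrite (cf k r) (interpolant_coordinatewise f k r) !IHr.
Qed.

End Interpolation.

Section ParallelTwist.
Context {R : realType} {D : link_diagram -> ratfun R}
  (HD : is_D_polynomial D) {u v : seq slice} {i : nat} {s : level}
  (run_u : run [::] u = Some s)
  (parallel : take 2 (drop i s) = [:: true; true])
  (run_v : run s v = Some [::]).

Lemma run_cross (o : bool) : run s [:: (i, Cross o)] = Some s.
Proof. by case: o; [apply: (run_braid 1) | apply: (run_braid (Negz 0))]. Qed.

Lemma insert_subproof {x : seq slice} :
  run s x = Some s -> run [::] (u ++ x ++ v) == Some [::].
Proof. by move=> xs; rewrite !run_cat run_u /= run_cat xs /= run_v. Qed.

Definition twist (a : int) : link_diagram :=
  LinkDiagram (insert_subproof (run_braid a parallel)).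

Lemma run_braid_cross (a : int) (o : bool) :
  run s (braid i a ++ [:: (i, Cross o)]) = Some s.
Proof. by rewrite run_cat run_braid //= run_cross. Qed.

(** The skein relation needs a visible crossing below the braid, even where it would cancel the last
    letter of $x_1^a$. *)
Definition twist_cross (a : int) (o : bool) : link_diagram :=
  LinkDiagram (insert_subproof (run_braid_cross a o)).

(** Either the new crossing extends the word, or it is opposite to the last letter; the second
    Reidemeister move then removes the pair. *)
Lemma braid_rcons (a : int) (o : bool) (b := if o then a + 1 else a - 1) :
  braid i a ++ [:: (i, Cross o)] = braid i b \/
  braid i a = braid i b ++ [:: (i, Cross (~~ o))].
Proof.
have nseqr n o' : nseq n (i, Cross o') ++ [:: (i, Cross o')]
    = nseq n.+1 (i, Cross o') by rewrite -addn1 nseqD.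
rewrite {}/b; case: o; case: a => n.
- by left; rewrite -PoszD addn1 nseqr.
- right; case: n => [|n] //.
  have -> : Negz n.+1 + 1 = Negz n by lia.
  by rewrite nseqr.
- case: n => [|n]; first by left.
  have -> : Posz n.+1 - 1 = Posz n by lia.
  by right; rewrite nseqr.
- have -> : Negz n - 1 = Negz n.+1 by lia.
  by left; rewrite nseqr.
Qed.

Lemma D_twist_cross (a : int) (o : bool) :
  D (twist_cross a o) = D (twist (if o then a + 1 else a - 1)).
Proof.
case: (braid_rcons a o) => E.
  by congr D; apply: val_inj; rewrite /= E.
apply: (D_invariant HD (u := u ++ braid i (if o then a + 1 else a - 1))
         (v := v) (move_R2 i (~~ o))); last by rewrite /= -!catA.
by rewrite /= E negbK -!catA.
Qed.

Lemma twist_recurrence (a : int) :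
  var_s R * D (twist (a - 1)) + (var_s R)^-1 * D (twist (a + 1))
    - 2 * D (twist a) = 0.
Proof.
rewrite -(D_twist_cross a false) -(D_twist_cross a true).
apply: (D_skein HD).
(* With both strands downwards, the positive crossing is [Cross false], that is $x_1^{-1}$, whence
   $a-1$ for $L_+$; the smoothing is the empty word. *)
exists (u ++ braid i a), v, i, s, (drop 2 (drop i s)), true, true.
split; rewrite /= -?catA //; split.
  by rewrite run_cat run_u /= run_braid.
by rewrite -[LHS](cat_take_drop 2) parallel.
Qed.

Lemma D_twist (a : int) :
  D (twist a) = Rcoef R 0 a * D (twist 0) + Rcoef R 1 a * D (twist 1).
Proof.
apply: (double_root_recurrence _ (fun a => D (twist a))) a.
  by rewrite tofrac_eq0 polyX_eq0.
exact: twist_recurrence.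
Qed.

End ParallelTwist.

Lemma item_run_cat (p : nat) (s : level) (t1 t2 : seq (item p)) :
  item_run s (t1 ++ t2) = obind (fun s1 => item_run s1 t2) (item_run s t1).
Proof.
rewrite /item_run foldl_cat; case: (foldl _ _ t1) => //=.
by elim: t2.
Qed.

Lemma split_disc (p : nat) (t : seq (item p)) (r : 'I_p) :
    r \in pmap (@disc_label p) t ->
  exists t1 i t2, t = t1 ++ Disc r i :: t2.
Proof.
elim: t => // x t IHt.
have cons_split : r \in pmap (@disc_label p) t ->
    exists t1 i t2, x :: t = t1 ++ Disc r i :: t2.
  by move=> /IHt [t1 [i [t2 ->]]]; exists (x :: t1), i, t2.
case: x cons_split => [y|q i] //= H; rewrite inE => /predU1P[<-|//].
by exists [::], i, t.
Qed.

Lemma fill_setc (p : nat) (k : {ffun 'I_p -> int}) (r : 'I_p) (a : int)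
    (t : seq (item p)) :
  r \notin pmap (@disc_label p) t -> fill (setc k r a) t = fill k t.
Proof.
rewrite /fill; elim: t => //= x t IHt.
case: x => [y|q i] /=; first by move=> /IHt ->.
by rewrite inE negb_or eq_sym => /andP[/negbTE qr /IHt ->]; rewrite ffunE qr.
Qed.

(** The template is cut at disc [r]. Labels do not repeat, so the parts above and below do not
    depend on [k r], and varying [k r] only twists two parallel strands. *)
Lemma D_family_coordinatewise {R : realType} {D : link_diagram -> ratfun R}
    (HD : is_D_polynomial D) (p : nat) (F : disc_family p) :
  coordinatewise (fun k => D (family_diagram F k)).
Proof.
move=> k r.
have discs := template_discs F.
have /split_disc [t1 [i [t2 Ft]]] : r \in pmap (@disc_label p) F.
  by rewrite (perm_mem discs) mem_enum.
have : uniq (pmap (@disc_label p) F) by rewrite (perm_uniq discs) enum_uniq.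
rewrite Ft pmap_cat /= cat_uniq /= negb_or.
move=> /and3P[_ /andP[rt1 _] /andP[rt2 _]].
(* Since the template runs successfully, there is a level [s] at the disc, and the test made there
   yields [parallel]. *)
have := template_run F; rewrite Ft item_run_cat.
case run1: (item_run _ t1) => [s|] //=; rewrite -cat1s item_run_cat /=.
rewrite [X in obind _ X]/item_run /=; case: ifP => [/eqP parallel|] //= run2.
have ru := run_fill k run1; have rv := run_fill k run2.
have twistE a : D (family_diagram F (setc k r a))
    = D (twist ru parallel rv a).
  congr D; apply: val_inj; rewrite /= Ft /fill map_cat flatten_cat /=.
  by rewrite -/(fill _ t1) -/(fill _ t2) !fill_setc // ffunE eqxx.
have setk : setc k r (k r) = k.
  by apply/ffunP => q; rewrite ffunE; case: eqP => [->|].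
by rewrite -[in LHS]setk !twistE (D_twist HD).
Qed.

Theorem corollary1p9 (R : realType) (D : link_diagram -> ratfun R)
    (HD : is_D_polynomial D) (p : nat) (F : disc_family p)
    (k : {ffun 'I_p -> int}) :
  D (family_diagram F k) =
  \sum_(j : {ffun 'I_p -> 'I_2})
     (\prod_(r < p) Rcoef R (j r) (k r)) *
     D (family_diagram F [ffun r => Posz (j r)]).
Proof.
exact: (coordinatewise_interpolant _ (D_family_coordinatewise HD p F)).
Qed.
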